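(* If the set of extreme points of the spectral scale $B$ is countable, then $N$ is abelian.
   Context: $M$ is a finite von Neumann algebra with a faithful normal tracial state $\tau$, $n$ is a positive integer, and $b_1,\dots,b_n\in M$ are self-adjoint; $N$ is the von Neumann subalgebra of $M$ generated by $b_1,\dots,b_n$ and $1$. $M_1^+=\{a\in M:0\le a\le 1\}$, $\Psi(a)=(\tau(a),\tau(b_1a),\dots,\tau(b_na))$, and $B=\Psi(M_1^+)\subset\mathbb R^{n+1}$ is the spectral scale of the $b_i$'s relative to $\tau$, a compact convex set. *)

(* Defs.v *)
From HB Require Import structures.
From mathcomp Require Import all_boot all_order all_algebra.
From mathcomp Require Import sesquilinear complex.
From mathcomp Require Import all_classical all_reals all_analysis.

Set Implicit Arguments.
Unset Strict Implicit.
Unset Printing Implicit Defensive.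

Import Order.TTheory GRing.Theory Num.Theory.
Import numFieldNormedType.Exports.

Local Open Scope classical_set_scope.
Local Open Scope complex_scope.
Local Open Scope ring_scope.

(* The inner product is linear in its first argument and conjugate-linear in
   the second. A completeNormedModType over R[i] together with such a product
   inducing its norm is a complex Hilbert space. *)
Notation inner_product H := {dot H for Num.conj}.

Definition induces_norm (R : realType) (H : completeNormedModType R[i])
    (dot : inner_product H) :=
  forall x : H, `|x| ^+ 2 = dot x x.

(* Operators are plain functions H -> H: linear combinations are pointwise,
   the product is \o and the unit is id. *)
Definition bounded_op (R : realType) (H : completeNormedModType R[i]) :
    set (H -> H) :=
  [set a | linear a /\ continuous a].

Section Operators.
Variables (R : realType) (H : completeNormedModType R[i]).
Variable dot : inner_product H.
Implicit Types (a c d : H -> H) (M D : set (H -> H)).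

Definition adjoint_pair a c := forall x y, dot (a x) y = dot x (c y).

Definition self_adjoint a := adjoint_pair a a.

(* On a complex Hilbert space a positive bounded operator is automatically
   self-adjoint; 0 <= z in R[i] entails that z is real. *)
Definition op_le a c := forall x, 0 <= dot (c x - a x) x.

Definition matrix_coef a : {ptws H * H -> R[i]^o} :=
  fun p => dot (a p.1) p.2.

(* The weak operator topology is the initial topology for matrix_coef; closed
   means closed in the space of bounded operators. *)
Definition wot_closed M :=
  forall c, bounded_op c ->
    closure (matrix_coef @` M) (matrix_coef c) -> M c.

Record von_neumann_algebra M : Prop := VonNeumannAlgebra {
  vna_bounded : M `<=` @bounded_op R H ;
  vna_one : M id ;
  vna_lin : forall (k : R[i]) a c, M a -> M c -> M (k *: a + c) ;
  vna_mul : forall a c, M a -> M c -> M (a \o c) ;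
  vna_adj : forall a, M a -> exists2 c, M c & adjoint_pair a c ;
  vna_closed : wot_closed M
}.

(* Every isometry of M is unitary, that is, the projection 1 is finite. *)
Definition finite_vna M :=
  forall v w, M v -> M w -> adjoint_pair v w -> w \o v = id -> v \o w = id.

Definition sa_part M : set (H -> H) := M `&` self_adjoint.

Definition upward_directed D :=
  forall c d, D c -> D d -> exists e, [/\ D e, op_le c e & op_le d e].

Definition sa_lub M D a :=
  [/\ sa_part M a, forall d, D d -> op_le d a
    & forall c, sa_part M c -> (forall d, D d -> op_le d c) -> op_le a c].

Section State.
Variables (M : set (H -> H)) (tau : (H -> H) -> R[i]).

(* tau preserves suprema of bounded increasing nets in M_sa. *)
Definition normal_functional :=
  forall D a, D `<=` sa_part M -> D !=set0 -> upward_directed D ->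
    sa_lub M D a -> supremums (tau @` D) (tau a).

(* The values of tau outside M are irrelevant. *)
Record faithful_normal_tracial_state : Prop := FaithfulNormalTracialState {
  tau_lin : forall (k : R[i]) a c, M a -> M c ->
    tau (k *: a + c) = k * tau a + tau c ;
  tau_ge0 : forall a, M a -> op_le 0 a -> 0 <= tau a ;
  tau_one : tau id = 1 ;
  tau_tracial : forall a c, M a -> M c -> tau (a \o c) = tau (c \o a) ;
  tau_faithful : forall a, M a -> op_le 0 a -> tau a = 0 -> a = 0 ;
  tau_normal : normal_functional
}.

End State.

Definition generated_vna M (S : set (H -> H)) : set (H -> H) :=
  smallest [set P | von_neumann_algebra P /\ P `<=` M] S.

Definition positive_unit_ball M : set (H -> H) :=
  [set a | [/\ M a, op_le 0 a & op_le a id]].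

(* tau a and tau (b i \o a) are real for self-adjoint a and b i, so that taking
   real parts only changes the codomain. *)
Definition scale_map (tau : (H -> H) -> R[i]) n (b : 'I_n -> H -> H) a :
    'rV[R]_(1 + n) :=
  row_mx (complex.Re (tau a))%:M (\row_i complex.Re (tau (b i \o a))).

Definition spectral_scale M (tau : (H -> H) -> R[i]) n (b : 'I_n -> H -> H) :
    set 'rV[R]_(1 + n) :=
  scale_map tau b @` positive_unit_ball M.

End Operators.

Definition abelian_ops (T : Type) (N : set (T -> T)) :=
  forall a c, N a -> N c -> a \o c = c \o a.

Definition extreme_points (R : realType) (V : lmodType R) (B : set V) : set V :=
  [set x | B x /\ forall (y z : V) (t : R), B y -> B z -> 0 < t < 1 ->
     x = t *: y + (1 - t) *: z -> y = x /\ z = x].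

(* Main.v *)
Require Import Defs.
From HB Require Import structures.
From mathcomp Require Import all_boot all_order all_algebra.
From mathcomp Require Import sesquilinear complex.
From mathcomp Require Import all_classical all_reals all_analysis.
From mathcomp Require Import ring lra.

(** Why the theorem is true.

    Write [tau] for the trace, [Psi] for the map defining the spectral scale
    [B], and call [0 <= x <= 1] the ball of [M].

    For a self-adjoint [d] in [M], let [p] be the spectral projection of [d] for
    the open half line of negative numbers. Then [tau (d x)] is smallest on the
    ball at [x = p], and among all minimisers [p] is the only one whose trace is
    smallest (negative_projection_min, negative_projection_face). For
    [d = b_i + th b_j - s] the number [tau (d x)] is a linear function of
    [Psi x], and [tau x] is a coordinate of [Psi x]; so [Psi p] is an extreme
    point of [B], and [p] is the only element of the ball above it
    (scale_map_extreme, scale_map_inj).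

    Fix [i] and [j], and let [p th s] be this projection. Call [th] bad if some
    [p th s] does not commute with [b_j], and choose such an [s] for each bad
    [th]. The extreme point [Psi (p th s)] determines [p th s], and a projection
    shared by two different values of [th] commutes with two different members
    of the pencil [b_i + th b_j], hence with [b_j]. So the bad [th] inject into
    the extreme points of [B] and are countable, whereas the real line is not:
    some [th] is good (generators_commute).

    For a good [th], all the projections [p th s] of [a = b_i + th b_j] commute
    with [c = b_j], and so does [a], because it is a limit of combinations of
    them. This is carried out on the commutator [w = a c - c a]: if [q] is the
    projection of [a] for an interval [s, s + r), then [a - s] is between [0]
    and [r] on the range of [q], and the trace of [w^* w q] is a double
    commutator tested against [(a - s) q]; it is at most a constant times
    [r tau q]. Summing over a partition of an interval containing the spectrum
    gives [tau (w^* w) <= C r] for every [r > 0], so that [w = 0]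
    (retr_step, commute_of_neg_proj). Then [b_i b_j = b_j b_i], and an algebra
    generated by commuting self-adjoint operators is abelian: it is contained in
    the commutant of its commutant, relative to [M] (generated_vna_abelian).

    The projection of [d] is obtained from monotone sequences in [M], which
    converge strongly to elements of [M] (vigier): one yields square roots of
    positive elements (sqrt_exists), another the projection onto the closure of
    the range of a self-adjoint element (support_projection). The projection of
    [d] is then the support of [|d| - d]. *)

Set Implicit Arguments.
Unset Strict Implicit.
Unset Printing Implicit Defensive.

Import Order.TTheory GRing.Theory Num.Theory.
Import numFieldNormedType.Exports.

Local Open Scope classical_set_scope.
Local Open Scope complex_scope.
Local Open Scope ring_scope.

(** * The real inner product *)

(** All inequalities are between real numbers once the real part of the inner
    product is taken; [rdot] has the same norm, hence the same convergence. *)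
Section RealInnerProduct.
Variables (R : realType) (H : completeNormedModType R[i]).
Variable dot : inner_product H.
Hypothesis hH : induces_norm dot.

Definition rdot (u v : H) : R := complex.Re (dot u v).

Lemma dotC u v : dot u v = conjc (dot v u).
Proof. by have := hermC dot u v; rewrite expr0 mul1r. Qed.

Lemma rdotC u v : rdot u v = rdot v u.
Proof. by rewrite /rdot dotC; case: (dot v u). Qed.

Lemma rdotDl u v w : rdot (u + v) w = rdot u w + rdot v w.
Proof. by rewrite /rdot linearDl raddfD. Qed.

Lemma rdotDr u v w : rdot w (u + v) = rdot w u + rdot w v.
Proof. by rewrite /rdot linearDr raddfD. Qed.

Lemma rdotNl u v : rdot (- u) v = - rdot u v.
Proof. by rewrite /rdot linearNl raddfN. Qed.

Lemma rdotNr u v : rdot u (- v) = - rdot u v.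
Proof. by rewrite /rdot linearNr raddfN. Qed.

Lemma rdotBl u v w : rdot (u - v) w = rdot u w - rdot v w.
Proof. by rewrite rdotDl rdotNl. Qed.

Lemma rdotBr u v w : rdot w (u - v) = rdot w u - rdot w v.
Proof. by rewrite rdotDr rdotNr. Qed.

Lemma ltr0c (k : R) : (0 < k%:C) = (0 < k).
Proof. by rewrite ltcE /= eqxx. Qed.

Lemma Re_scale (k : R) (z : R[i]) : complex.Re (k%:C * z) = k * complex.Re z.
Proof. by case: z => a b /=; rewrite mul0r subr0. Qed.

Lemma rdotZl k u v : rdot (k%:C *: u) v = k * rdot u v.
Proof. by rewrite /rdot linearZl_LR /= Re_scale. Qed.

Lemma rdotZr k u v : rdot u (k%:C *: v) = k * rdot u v.
Proof. by rewrite rdotC rdotZl rdotC. Qed.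

Lemma dot_norm u : dot u u = (rdot u u)%:C.
Proof.
by apply/esym/RRe_real; rewrite -hH; apply: ger0_real; rewrite exprn_ge0.
Qed.

Lemma rdot_ge0 u : 0 <= rdot u u.
Proof. by rewrite -ler0c -dot_norm -hH exprn_ge0. Qed.

Lemma rdot_eq0 u : rdot u u = 0 -> u = 0.
Proof.
move=> u0; have /eqP : `|u| ^+ 2 = 0 by rewrite hH dot_norm u0.
by rewrite expf_eq0 /= normr_eq0 => /eqP.
Qed.

Lemma rdot_inj u v : (forall w, rdot u w = rdot v w) -> u = v.
Proof.
move=> uv; apply/eqP; rewrite -subr_eq0; apply/eqP/rdot_eq0.
by rewrite rdotBl uv subrr.
Qed.

Lemma norm_rdot u : `|u| = (Num.sqrt (rdot u u))%:C.
Proof.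
apply: (@pexpIrn _ 2) => //; rewrite ?nnegrE ?normr_ge0 ?ler0c ?sqrtr_ge0 //.
by rewrite hH dot_norm -rmorphXn /= sqr_sqrtr // rdot_ge0.
Qed.

(** [v] is rescaled instead of divided: the square of [(v,v) u - (u,v) v] is
    [(v,v)] times the difference of the two sides. *)
Lemma cauchy_schwarz u v : rdot u v ^+ 2 <= rdot u u * rdot v v.
Proof.
have [v0|] := eqVneq (rdot v v) 0.
  by rewrite (rdot_eq0 v0) -(scale0r 0) rdotZr mul0r expr0n mulr_ge0 ?rdot_ge0.
move=> v0; have vp : 0 < rdot v v by rewrite lt0r v0 rdot_ge0.
have := rdot_ge0 ((rdot v v)%:C *: u - (rdot u v)%:C *: v).
rewrite !(rdotBl, rdotBr, rdotZl, rdotZr) (rdotC v u).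
move: (rdot u u) (rdot u v) (rdot v v) vp => a b c cp h.
have : 0 <= c * (a * c - b ^+ 2) by move: h; congr (_ <= _); ring.
by rewrite pmulr_rge0 // subr_ge0.
Qed.

(** The norm of [H] has complex values; this expresses its topology through
    [rdot]. *)
Lemma cvg_rdotP (w : nat -> H) (l : H) :
  (w @ \oo --> l) <->
  (forall e : R, 0 < e -> \forall n \near \oo, rdot (w n - l) (w n - l) <= e).
Proof.
split=> [/cvgrPdist_le cw e e0|cw].
- have se : 0 < (Num.sqrt e)%:C by rewrite ltr0c sqrtr_gt0.
  near=> n.
  have : `|l - w n| <= (Num.sqrt e)%:C by near: n; exact: cw.
  by rewrite distrC norm_rdot lecR ler_sqrt // ltW.
apply/cvgrPdist_le => e e0.
have er : e = (complex.Re e)%:C by rewrite RRe_real // gtr0_real.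
have re0 : 0 < complex.Re e by rewrite -ltr0c -er.
near=> n; rewrite distrC norm_rdot er lecR -(ger0_norm (ltW re0)) -sqrtr_sqr.
by rewrite ler_sqrt ?sqr_ge0 //; near: n; apply: cw; rewrite exprn_gt0.
Unshelve. all: by end_near. Qed.

Lemma cvg_rdotl (w : nat -> H) (l v : H) :
  w @ \oo --> l -> (fun n => rdot (w n) v) @ \oo --> rdot l v.
Proof.
move=> /cvg_rdotP cw; apply/cvgrPdist_le => e e0.
have d0 : 0 < e ^+ 2 / (rdot v v + 1).
  by rewrite divr_gt0 ?exprn_gt0 // ltr_pwDr // rdot_ge0.
near=> n; rewrite distrC -rdotBl -ler_sqr ?nnegrE ?normr_ge0 ?(ltW e0) //.
rewrite real_normK ?num_real // (le_trans (cauchy_schwarz _ _)) //.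
have h : rdot (w n - l) (w n - l) <= e ^+ 2 / (rdot v v + 1).
  by near: n; exact: cw.
rewrite ler_pdivlMr in h; last by rewrite ltr_pwDr // rdot_ge0.
have := rdot_ge0 (w n - l); have := rdot_ge0 v; nra.
Unshelve. all: by end_near. Qed.

(** Polarisation: the quadratic form is real at [u + v] and at [u + i v], which
    gives the real and the imaginary part of the identity. *)
Lemma positive_self_adjoint (a : H -> H) : linear a ->
  (forall v, 0 <= dot (a v) v) -> self_adjoint dot a.
Proof.
move=> la pa u v.
have aD x y : a (x + y) = a x + a y by have := la 1 x y; rewrite !scale1r.
have a0 : a 0 = 0 by apply: (addrI (a 0)); rewrite -aD !addr0.
have aZ k x : a (k *: x) = k *: a x by rewrite -[k *: x]addr0 la a0 addr0.
have re x : dot (a x) x = conjc (dot (a x) x).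
  by have := ger0_Im (pa x); case: (dot _ _) => c d /= ->; rewrite /= oppr0.
rewrite (dotC u).
have := re (u + v); have := re (u + 'i *: v).
rewrite !(aD, aZ, linearDl, linearDr, linearZl_LR, linearZr_LR) /=.
have := re u; have := re v.
case: (dot (a u) u) => uu1 uu2; case: (dot (a v) v) => vv1 vv2.
case: (dot (a u) v) => uv1 uv2; case: (dot (a v) u) => vu1 vu2 /=.
simpc => [[h1]] [h2] [h3] [h4]; apply/eqP; rewrite eq_complex /=.
by apply/andP; split; apply/eqP; lra.
Qed.

(** The imaginary part of [dot (a u) v] is minus the real part of
    [dot (a (i u)) v], so that self-adjointness for [rdot] suffices. *)
Lemma real_self_adjoint (a : H -> H) : linear a ->
  (forall u v, rdot (a u) v = rdot u (a v)) -> self_adjoint dot a.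
Proof.
move=> la ha u v.
have a0 : a 0 = 0.
  by apply: (addrI (a 0)); have := la 1 0 0; rewrite !scale1r !addr0 => <-.
have aZ k x : a (k *: x) = k *: a x by rewrite -[k *: x]addr0 la a0 addr0.
have h1 := ha u v; have := ha ('i *: u) v.
rewrite aZ /rdot !linearZl_LR /=; move: h1; rewrite /rdot.
case: (dot (a u) v) => x y; case: (dot u (a v)) => z t /=; simpc => -> /eqP.
by rewrite eqr_opp => /eqP ->.
Qed.

End RealInnerProduct.

(** * The algebra as a ring of operators *)
Section OperatorRing.
Variables (R : realType) (H : completeNormedModType R[i]).
Variables (dot : inner_product H) (M : set (H -> H)).

(** The type depends on [hM] because the ring operations need the closure
    properties of [M]. The scalars are restricted to the real numbers, in
    accordance with [rdot]. *)
Record op (hM : von_neumann_algebra dot M) :=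
  Op { opfun :> H -> H ; opP : M opfun }.

Variable hM : von_neumann_algebra dot M.

Lemma op_ext (x y : op hM) : (forall v, x v = y v) -> x = y.
Proof.
case: x y => a Ma [c Mc] /= /funext ac; move: Mc; rewrite -ac => Mc.
by rewrite (Prop_irrelevance Ma Mc).
Qed.

Lemma op_linear (x : op hM) : linear x.
Proof. by case: (vna_bounded hM (opP x)). Qed.

Lemma op_continuous (x : op hM) : continuous x.
Proof. by case: (vna_bounded hM (opP x)). Qed.

Lemma vna0 : M 0.
Proof.
have := vna_lin hM (-1) (vna_one hM) (vna_one hM).
by rewrite scaleN1r addNr.
Qed.

Lemma vnaD a c : M a -> M c -> M (a + c).
Proof. by move=> Ma Mc; rewrite -[a]scale1r; exact: (vna_lin hM). Qed.

Lemma vnaZ k a : M a -> M (k *: a).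
Proof. by move=> Ma; rewrite -[_ *: _]addr0; exact: (vna_lin hM _ Ma vna0). Qed.

Lemma vnaN a : M a -> M (- a).
Proof. by move=> Ma; rewrite -scaleN1r; exact: vnaZ. Qed.

Definition op0 : op hM := Op hM vna0.
Definition op1 : op hM := Op hM (vna_one hM).
Definition opD (x y : op hM) : op hM := Op hM (vnaD (opP x) (opP y)).
Definition opN (x : op hM) : op hM := Op hM (vnaN (opP x)).
Definition opZ (k : R) (x : op hM) : op hM := Op hM (vnaZ k%:C (opP x)).
Definition opM (x y : op hM) : op hM := Op hM (vna_mul hM (opP x) (opP y)).

HB.instance Definition _ := gen_eqMixin (op hM).
HB.instance Definition _ := gen_choiceMixin (op hM).

Fact opDA : associative opD.
Proof. by move=> x y z; apply: op_ext => v; exact: addrA. Qed.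
Fact opDC : commutative opD.
Proof. by move=> x y; apply: op_ext => v; exact: addrC. Qed.
Fact op0D : left_id op0 opD.
Proof. by move=> x; apply: op_ext => v; exact: add0r. Qed.
Fact opND : left_inverse op0 opN opD.
Proof. by move=> x; apply: op_ext => v; exact: addNr. Qed.

HB.instance Definition _ := GRing.isZmodule.Build (op hM) opDA opDC op0D opND.

Lemma opfunD (x : op hM) u v : x (u + v) = x u + x v.
Proof. by have := op_linear x 1 u v; rewrite !scale1r. Qed.

Lemma opfun0 (x : op hM) : x 0 = 0.
Proof. by apply: (addrI (x 0)); rewrite -opfunD !addr0. Qed.

Lemma opfunZ (x : op hM) k v : x (k *: v) = k *: x v.
Proof. by rewrite -[k *: v]addr0 op_linear opfun0 addr0. Qed.

Lemma opfunN (x : op hM) v : x (- v) = - x v.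
Proof. by rewrite -scaleN1r opfunZ scaleN1r. Qed.

Lemma opfunB (x : op hM) u v : x (u - v) = x u - x v.
Proof. by rewrite opfunD opfunN. Qed.

Fact opMA : associative opM. Proof. by move=> x y z; exact: op_ext. Qed.
Fact op1M : left_id op1 opM. Proof. by move=> x; exact: op_ext. Qed.
Fact opM1 : right_id op1 opM. Proof. by move=> x; exact: op_ext. Qed.
Fact opMDl : left_distributive opM +%R.
Proof. by move=> x y z; exact: op_ext. Qed.
Fact opMDr : right_distributive opM +%R.
Proof. by move=> x y z; apply: op_ext => v; exact: opfunD. Qed.

HB.instance Definition _ :=
  GRing.Zmodule_isPzRing.Build (op hM) opMA op1M opM1 opMDl opMDr.

Fact opZA a b (x : op hM) : opZ a (opZ b x) = opZ (a * b) x.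
Proof. by apply: op_ext => v; rewrite /opfun /= fctE scalerA -rmorphM. Qed.
Fact op1Z : left_id 1 opZ.
Proof. by move=> x; apply: op_ext => v; exact: scale1r. Qed.
Fact opZDr : right_distributive opZ +%R.
Proof. by move=> a x y; apply: op_ext => v; exact: scalerDr. Qed.
Fact opZDl (x : op hM) : {morph opZ^~ x : a b / a + b}.
Proof.
by move=> a b; apply: op_ext => v; rewrite /opfun /= !fctE rmorphD scalerDl.
Qed.

HB.instance Definition _ :=
  GRing.Zmodule_isLmodule.Build R (op hM) opZA op1Z opZDr opZDl.

Implicit Types x y z : op hM.

Lemma opDE x y v : (x + y) v = x v + y v. Proof. by []. Qed.
Lemma opNE x v : (- x) v = - x v. Proof. by []. Qed.
Lemma opME x y v : (x * y) v = x (y v). Proof. by []. Qed.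
Lemma opZE k x v : (k *: x) v = k%:C *: x v. Proof. by []. Qed.
Lemma op1E v : (1 : op hM) v = v. Proof. by []. Qed.
Lemma op0E v : (0 : op hM) v = 0. Proof. by []. Qed.
Definition opE := (opDE, opNE, opME, opZE, op1E, op0E).

Lemma op_scalerAl k x y : k *: (x * y) = (k *: x) * y.
Proof. exact: op_ext. Qed.

Lemma op_scalerAr k x y : k *: (x * y) = x * (k *: y).
Proof. by apply: op_ext => v; rewrite !opE opfunZ. Qed.

End OperatorRing.

(** * Self-adjoint and positive operators *)
Section OperatorOrder.
Variables (R : realType) (H : completeNormedModType R[i]).
Variables (dot : inner_product H) (M : set (H -> H)).
Hypothesis hH : induces_norm dot.
Variable hM : von_neumann_algebra dot M.
Implicit Types x y z c d : op hM.

Local Notation rd := (rdot dot).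

Definition sa x := forall u v, rd (x u) v = rd u (x v).
Definition pos x := sa x /\ forall v, 0 <= rd (x v) v.

Lemma sa0 : sa 0.
Proof. by move=> u v; rewrite !opE /rdot linear0l linear0r. Qed.

Lemma saD x y : sa x -> sa y -> sa (x + y).
Proof. by move=> sx sy u v; rewrite !opE rdotDl rdotDr sx sy. Qed.

Lemma saN x : sa x -> sa (- x).
Proof. by move=> sx u v; rewrite !opE rdotNl rdotNr sx. Qed.

Lemma saB x y : sa x -> sa y -> sa (x - y).
Proof. by move=> sx sy; apply: saD => //; exact: saN. Qed.

Lemma saZ k x : sa x -> sa (k *: x).
Proof. by move=> sx u v; rewrite !opE rdotZl rdotZr sx. Qed.

Lemma saM x y : sa x -> sa y -> x * y = y * x -> sa (x * y).
Proof. by move=> sx sy xy u v; rewrite {2}xy !opE sx sy. Qed.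

Lemma sa_conj c x : sa c -> sa x -> sa (c * x * c).
Proof. by move=> sc sx u v; rewrite !opE sc sx sc. Qed.

Lemma pos0 : pos 0.
Proof. by split=> [|v]; [exact: sa0|rewrite opE /rdot linear0l]. Qed.

Lemma pos1 : pos 1.
Proof. by split=> // v; rewrite opE; exact: rdot_ge0. Qed.

Lemma posD x y : pos x -> pos y -> pos (x + y).
Proof.
move=> [sx px] [sy py]; split=> [|v]; first exact: saD.
by rewrite opE rdotDl addr_ge0.
Qed.

Lemma posZ k x : 0 <= k -> pos x -> pos (k *: x).
Proof.
move=> k0 [sx px]; split=> [|v]; first exact: saZ.
by rewrite opE rdotZl mulr_ge0.
Qed.

Lemma pos_conj c x : sa c -> pos x -> pos (c * x * c).
Proof.
by move=> sc [sx px]; split=> [|v]; [exact: sa_conj|rewrite !opE sc].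
Qed.

Lemma pos_sqr c : sa c -> pos (c * c).
Proof.
by move=> sc; rewrite -[c in c * _]mulr1; apply: pos_conj => //; exact: pos1.
Qed.

Lemma posX x n : pos x -> pos (x ^+ n).
Proof.
move=> px; elim/ltn_ind: n => -[|[|n]] ih; [exact: pos1|exact: px|].
by rewrite exprS exprSr mulrA; apply: pos_conj; [exact: px.1|exact: ih].
Qed.

(** This is [x^2 <= x], which holds because
    [x - x^2 = (1 - x) x (1 - x) + x (1 - x) x]. *)
Lemma sqnorm_le x v : pos x -> pos (1 - x) -> rd (x v) (x v) <= rd (x v) v.
Proof.
move=> [sx px] [_ qx].
have := px (v - x v); have := qx (x v).
rewrite !opE opfunB !(rdotBl, rdotBr, rdotDl, rdotNl) (sx (x v) v); lra.
Qed.

Lemma pos_conj_eq0 c x : sa c -> pos x -> pos (1 - x) -> c * x * c = 0 ->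
  x * c = 0.
Proof.
move=> sc px qx h; apply: op_ext => v; apply: (rdot_eq0 hH); apply/eqP.
rewrite eq_le rdot_ge0 // andbT opE.
rewrite (le_trans (sqnorm_le _ px qx)) // -sc -!opME h.
by rewrite opE /rdot linear0l.
Qed.

Lemma sa_sqr_eq0 c : sa c -> c * c = 0 -> c = 0.
Proof.
move=> sc h; apply: op_ext => v; apply: (rdot_eq0 hH).
by rewrite sc -opME h opE /rdot linear0r.
Qed.

HB.instance Definition _ x :=
  GRing.isLinear.Build R[i] H H *:%R (opfun x) (op_linear x).

Lemma sqnorm_bound x : exists2 K : R, 0 < K &
  forall v, rd (x v) (x v) <= K ^+ 2 * rd v v.
Proof.
have /linear_bounded_continuous/linear_boundedP/pinfty_ex_gt0 :=
  @op_continuous _ _ _ _ _ x.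
move=> [K K0 xK].
have Kr : K = (complex.Re K)%:C by rewrite RRe_real // gtr0_real.
exists (complex.Re K); first by rewrite -ltr0c -Kr.
move=> v; have := xK v; rewrite !(norm_rdot hH) {1}Kr -rmorphM /= lecR.
move=> h; rewrite -[X in X <= _]sqr_sqrtr ?rdot_ge0 //.
rewrite -[rd v v]sqr_sqrtr ?rdot_ge0 // -exprMn ler_sqr ?nnegrE ?sqrtr_ge0 //.
by rewrite mulr_ge0 ?sqrtr_ge0 // -ler0c -Kr ltW.
Qed.

(** The square of [(K - x) v] is at most [2 K] times [((K - x) v, v)] as soon as
    [K] bounds the norm of [x]. *)
Lemma sa_bounded x : sa x -> exists2 K : R, 0 < K &
  pos (K *: (1 : op hM) - x) /\ pos (K *: (1 : op hM) + x).
Proof.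
move=> sx; have [K K0 xK] := sqnorm_bound x; exists K => //.
have s1 : sa (K *: (1 : op hM)) by apply: saZ.
split; split=> [|v]; [exact: saB| |exact: saD|].
- have := rdot_ge0 hH (K%:C *: v - x v); have := xK v.
  rewrite !opE !(rdotBl, rdotBr, rdotZl, rdotZr) -(sx v v) => h1 h2.
  rewrite -(pmulr_rge0 _ (mulr_gt0 (ltr0Sn R 1) K0)); lra.
- have := rdot_ge0 hH (K%:C *: v + x v); have := xK v.
  rewrite !opE !(rdotDl, rdotDr, rdotZl, rdotZr) -(sx v v) => h1 h2.
  rewrite -(pmulr_rge0 _ (mulr_gt0 (ltr0Sn R 1) K0)); lra.
Qed.

End OperatorOrder.

(** * Strong limits in the algebra *)
Section StrongLimits.
Variables (R : realType) (H : completeNormedModType R[i]).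
Variables (dot : inner_product H) (M : set (H -> H)).
Hypothesis hH : induces_norm dot.
Variable hM : von_neumann_algebra dot M.
Implicit Types (x y z c d : op hM) (u w : nat -> op hM).

Local Notation rd := (rdot dot).

Definition strong_lim u x := forall v : H, (fun n => u n v) @ \oo --> x v.

Lemma strong_lim_unique u x y : strong_lim u x -> strong_lim u y -> x = y.
Proof.
move=> ux uy; apply: op_ext => v.
exact: (cvg_unique (@norm_hausdorff _ H) (ux v) (uy v)).
Qed.

Lemma strong_lim_cst x : strong_lim (fun=> x) x.
Proof. by move=> v; exact: cvg_cst. Qed.

Lemma strong_limD u w x y : strong_lim u x -> strong_lim w y ->
  strong_lim (fun n => u n + w n) (x + y).
Proof. by move=> ux wy v; apply: cvgD; [exact: ux|exact: wy]. Qed.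

Lemma strong_limZ k u x : strong_lim u x ->
  strong_lim (fun n => k *: u n) (k *: x).
Proof. by move=> ux v; apply: cvgZl_tmp; exact: ux. Qed.

Lemma strong_limN u x : strong_lim u x -> strong_lim (fun n => - u n) (- x).
Proof. by move=> ux v; apply: cvgN; exact: ux. Qed.

Lemma strong_lim_mull z u x : strong_lim u x ->
  strong_lim (fun n => z * u n) (z * x).
Proof.
move=> ux v; apply: (@continuous_cvg _ _ _ _ _ _ (opfun z)).
  exact: op_continuous.
exact: ux.
Qed.

Lemma strong_lim_mulr z u x : strong_lim u x ->
  strong_lim (fun n => u n * z) (x * z).
Proof. by move=> ux v; exact: ux. Qed.

Lemma strong_lim_shift u x : strong_lim u x -> strong_lim (fun n => u n.+1) x.
Proof.
move=> ux v; have := ux v.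
by rewrite -(@cvg_shiftS _ (fun n => u n v)).
Qed.

Lemma strong_lim_comm d u x : strong_lim u x -> (forall n, d * u n = u n * d) ->
  d * x = x * d.
Proof.
move=> ux du; apply: (@strong_lim_unique (fun n => d * u n)).
  exact: strong_lim_mull.
by under eq_fun do rewrite du; exact: strong_lim_mulr.
Qed.

Lemma strong_lim_sa u x : strong_lim u x -> (forall n, sa (u n)) -> sa x.
Proof.
move=> ux su v w.
have h1 := cvg_rdotl hH (v := w) (ux v).
have h2 := cvg_rdotl hH (v := v) (ux w).
have e : (fun n => rd (u n v) w) = (fun n => rd (u n w) v).
  by apply/funext => n; rewrite su rdotC.
rewrite e in h1; rewrite (rdotC dot v).
exact: (cvg_unique (@Rhausdorff R) h1 h2).
Qed.

Lemma strong_lim_pos u x : strong_lim u x -> (forall n, pos (u n)) -> pos x.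
Proof.
move=> ux pu; split=> [|v]; first exact: strong_lim_sa ux (fun n => (pu n).1).
have h := cvg_rdotl hH (v := v) (ux v).
rewrite -(cvg_lim (@Rhausdorff R) h); apply: limr_ge.
  by apply/cvg_ex; eexists; exact: h.
by near=> n; exact: (pu n).2.
Unshelve. all: by end_near. Qed.

(** The product is jointly continuous here because each [u n] is a
    contraction. *)
Lemma strong_lim_sqr u x : (forall n, pos (u n)) -> (forall n, pos (1 - u n)) ->
  strong_lim u x -> strong_lim (fun n => u n * u n) (x * x).
Proof.
move=> pu qu ux v; apply/(cvg_rdotP hH) => e e0.
have /(cvg_rdotP hH)/(_ (e / 4)) k1 := ux v.
have /(cvg_rdotP hH)/(_ (e / 4)) k2 := ux (x v).
near=> n; rewrite !opE.
have h1 : rd (u n v - x v) (u n v - x v) <= e / 4.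
  by near: n; apply: k1; lra.
have h2 : rd (u n (x v) - x (x v)) (u n (x v) - x (x v)) <= e / 4.
  by near: n; apply: k2; lra.
have h3 : rd (u n (u n v - x v)) (u n (u n v - x v)) <=
      rd (u n v - x v) (u n v - x v).
  apply: le_trans (sqnorm_le _ (pu n) (qu n)) _.
  have := (qu n).2 (u n v - x v); rewrite !opE rdotBl; lra.
have -> : u n (u n v) - x (x v) =
    u n (u n v - x v) + (u n (x v) - x (x v)).
  by rewrite opfunB addrA subrK.
move: (u n (u n v - x v)) (u n (x v) - x (x v)) h2 h3 => a b h2 h3.
have := rdot_ge0 hH (a - b).
rewrite !(rdotDl, rdotDr, rdotNl, rdotNr); lra.
Unshelve. all: by end_near. Qed.

(** Follows from the real inequality applied to [a] and [(a,v) v], whose real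
    inner product is the squared modulus of [(a,v)]. *)
Lemma complex_cauchy_schwarz (a v : H) :
  complex.Re (dot a v) ^+ 2 + complex.Im (dot a v) ^+ 2 <= rd a a * rd v v.
Proof.
set r := _ + _; have r0 : 0 <= r by rewrite addr_ge0 // sqr_ge0.
have [<-|r1] := eqVneq 0 r; first by rewrite mulr_ge0 // rdot_ge0.
have rp : 0 < r by rewrite lt0r eq_sym r1.
have h1 : rd a (dot a v *: v) = r.
  rewrite /rdot linearZr_LR /= /r; case: (dot a v) => p q /=; ring.
have h2 : rd (dot a v *: v) (dot a v *: v) = r * rd v v.
  rewrite /rdot linearZr_LR linearZl_LR /= (dot_norm hH) /r.
  case: (dot a v) => p q /=; rewrite /rdot; ring.
have := cauchy_schwarz hH a (dot a v *: v); rewrite h1 h2.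
by rewrite mulrCA expr2 ler_pM2l.
Qed.

Lemma cvg_dotl (w : nat -> H) (l v : H) :
  w @ \oo --> l -> (fun n => dot (w n) v : R[i]^o) @ \oo --> (dot l v : R[i]^o).
Proof.
move=> /(cvg_rdotP hH) cw; apply/cvgrPdist_le => e e0.
have er : e = (complex.Re e)%:C by rewrite RRe_real // gtr0_real.
have re0 : 0 < complex.Re e by rewrite -ltr0c -er.
have d0 : 0 < complex.Re e ^+ 2 / (rd v v + 1).
  by rewrite divr_gt0 ?exprn_gt0 // ltr_pwDr // rdot_ge0.
near=> n; rewrite distrC -linearBl er normc_def lecR.
rewrite -(ger0_norm (ltW re0)) -sqrtr_sqr ler_sqrt ?sqr_ge0 //.
apply: le_trans (complex_cauchy_schwarz _ _) _.
have h : rd (w n - l) (w n - l) <= complex.Re e ^+ 2 / (rd v v + 1).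
  by near: n; exact: cw.
rewrite ler_pdivlMr in h; last by rewrite ltr_pwDr // rdot_ge0.
have := rdot_ge0 hH (w n - l); have := rdot_ge0 hH v; nra.
Unshelve. all: by end_near. Qed.

(** A strong limit of operators is a limit of their matrix coefficients, hence
    belongs to the weakly closed set [M]. *)
Lemma strong_lim_exists u (f : H -> H) : bounded_op f ->
  (forall v, (fun n => u n v) @ \oo --> f v) -> exists x, strong_lim u x.
Proof.
move=> bf uf; suff Mf : M f by exists (Op hM Mf).
apply: (vna_closed hM) => // B nB.
have : {ptws, (fun n => matrix_coef dot (u n)) @ \oo --> matrix_coef dot f}.
  apply/pointwise_cvgP => -[v w] /=; exact: cvg_dotl.
move=> /(_ B nB) [N _ hN]; exists (matrix_coef dot (u N)); split.
  by exists (u N) => //; exact: opP.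
exact: (hN N (leqnn N)).
Qed.

(** Increasing sequences in the unit ball converge strongly: for [m <= n] the
    difference [u n - u m] is between [0] and [1], so by [sqnorm_le] the squared
    distance of [u n v] and [u m v] is at most the increment of the bounded
    monotone real sequence [(u n v, v)]. *)
Lemma vigier u : (forall n, pos (u n)) -> (forall n, pos (1 - u n)) ->
  (forall n, pos (u n.+1 - u n)) -> exists x, strong_lim u x.
Proof.
move=> pu qu iu.
have mu m k : pos (u (m + k)%N - u m).
  elim: k => [|k ih]; first by rewrite addn0 subrr; exact: pos0.
  by rewrite addnS -(subrK (u (m + k)%N) (u _.+1)) -addrA; exact: posD.
have du m k v : rd (u (m + k)%N v - u m v) (u (m + k)%N v - u m v) <=
    rd (u (m + k)%N v) v - rd (u m v) v.
  rewrite -rdotBl; apply: (sqnorm_le (x := u (m + k)%N - u m)); first exact: mu.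
  by rewrite opprB addrCA; exact: posD.
have nd v : nondecreasing_seq (fun n => rd (u n v) v).
  move=> m n mn; rewrite -(subnKC mn) -subr_ge0.
  by apply: le_trans (du m (n - m)%N v); exact: rdot_ge0.
have ub v n : rd (u n v) v <= rd v v.
  by have := (qu n).2 v; rewrite !opE rdotBl subr_ge0.
have cs v : cvgn (fun n => rd (u n v) v).
  apply: nondecreasing_is_cvgn => //; exists (rd v v) => _ [n _ <-]; exact: ub.
have cu v : cvgn (fun n => u n v).
  apply/cauchy_cvgP/cauchy_exP => e e0.
  have er : e = (complex.Re e)%:C by rewrite RRe_real // gtr0_real.
  have re0 : 0 < complex.Re e by rewrite -ltr0c -er.
  have /cvgrPdist_lt/(_ _ (exprn_gt0 2 re0)) [N _ hN] := cs v.
  (* [N] is such that the remaining increments of [(u n v, v)] are small. *)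
  exists (u N v); exists N => // n /= Nn.
  rewrite -ball_normE /= distrC (norm_rdot hH) er ltcR.
  rewrite -[ltRHS](ger0_norm (ltW re0)) -sqrtr_sqr ltr_sqrt ?exprn_gt0 //.
  rewrite -(subnKC Nn); apply: le_lt_trans (du _ _ _) _.
  have := hN N (leqnn N); apply: le_lt_trans.
  rewrite subnKC //; apply: le_trans (ler_norm _).
  by rewrite lerB //; exact: (nondecreasing_cvgn_le (nd v)).
pose f v : H := lim ((fun n => u n v) @ \oo).
have uf v : (fun n => u n v) @ \oo --> f v by exact: cu.
have lf : linear f.
  move=> k v w; apply: (cvg_unique (@norm_hausdorff _ H) (uf (k *: v + w))).
  have -> : (fun n => u n (k *: v + w)) = (fun n => k *: u n v + u n w).
    by apply/funext => n; exact: op_linear.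
  by apply: cvgD => //; exact: cvgZl_tmp.
(* Pairing with the fixed vector [f v] makes the limit linear in [u n]. *)
have fle v : rd (f v) (f v) <= rd v v.
  have h : rd (f v) (f v) <= (rd v v + rd (f v) (f v)) / 2.
    have c := cvg_rdotl hH (v := f v) (uf v).
    rewrite -[leLHS](cvg_lim (@Rhausdorff R) c).
    apply: limr_le; first by apply/cvg_ex; eexists; exact: c.
    near=> n.
    have h1 := sqnorm_le v (pu n) (qu n); have h2 := ub v n.
    have := rdot_ge0 hH (u n v - f v).
    rewrite !(rdotBl, rdotBr) (rdotC dot (f v) (u n v)); lra.
  lra.
apply: (@strong_lim_exists u f) => //; split=> // v.
apply/cvgrPdist_le => e e0; near=> w.
have -> : f v - f w = f (v - w).
  by rewrite addrC -scaleN1r -lf scaleN1r addrC.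
apply: (@le_trans _ _ `|v - w|).
  by rewrite !(norm_rdot hH) lecR ler_sqrt ?rdot_ge0.
by near: w; exact: cvgr_dist_le.
Unshelve. all: by end_near. Qed.

End StrongLimits.

(** * Square roots, supports and spectral projections *)
Section FunctionalCalculus.
Variables (R : realType) (H : completeNormedModType R[i]).
Variables (dot : inner_product H) (M : set (H -> H)).
Hypothesis hH : induces_norm dot.
Variable hM : von_neumann_algebra dot M.
Implicit Types (x y z c d t e p : op hM).

Local Notation rd := (rdot dot).

Lemma op_commZ c k x : c * x = x * c -> c * (k *: x) = (k *: x) * c.
Proof. by move=> cx; rewrite -op_scalerAr cx op_scalerAl. Qed.

(** Polynomials in [t] with nonnegative coefficients. They are stable under
    products, and positive when [t] is; they make the increments of the
    iteration below positive. *)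
Inductive poly_cone t : op hM -> Prop :=
| poly_cone0 : poly_cone t 0
| poly_cone_cons k n x :
    0 <= k -> poly_cone t x -> poly_cone t (k *: t ^+ n + x).

Lemma poly_cone_pos t x : pos t -> poly_cone t x -> pos x.
Proof.
move=> pt; elim=> [|k n y k0 _ py]; first exact: pos0.
by apply: posD => //; apply: posZ => //; exact: posX.
Qed.

Lemma poly_cone_comm t x c : c * t = t * c -> poly_cone t x -> c * x = x * c.
Proof.
move=> ct; elim=> [|k n y _ _ cy]; first by rewrite mulr0 mul0r.
by rewrite mulrDr mulrDl cy op_commZ //; exact: commrX.
Qed.

Lemma poly_coneD t x y : poly_cone t x -> poly_cone t y -> poly_cone t (x + y).
Proof.
move=> nx ny; elim: nx => [|k n z k0 _ nz]; first by rewrite add0r.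
by rewrite -addrA; exact: poly_cone_cons.
Qed.

Lemma poly_coneZ t k x : 0 <= k -> poly_cone t x -> poly_cone t (k *: x).
Proof.
move=> k0; elim=> [|l n y l0 _ ny]; first by rewrite scaler0; exact: poly_cone0.
by rewrite scalerDr scalerA; apply: poly_cone_cons; rewrite // mulr_ge0.
Qed.

Lemma poly_coneM t x y : poly_cone t x -> poly_cone t y -> poly_cone t (x * y).
Proof.
move=> nx ny; elim: nx => [|k n z k0 _ nz]; last first.
  rewrite mulrDl; apply: poly_coneD => //; rewrite -op_scalerAl.
  apply: poly_coneZ => //.
  elim: ny => [|l m w l0 _ nw]; first by rewrite mulr0; exact: poly_cone0.
  by rewrite mulrDr -op_scalerAr -exprD; exact: poly_cone_cons.
by rewrite mul0r; exact: poly_cone0.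
Qed.

Lemma poly_cone_gen t : poly_cone t t.
Proof.
by have := poly_cone_cons 1 ler01 (poly_cone0 t); rewrite scale1r expr1 addr0.
Qed.

Lemma pos_sub_sqr x : pos x -> pos (1 - x) -> pos (x - x * x).
Proof.
move=> px qx; split=> [|v]; first exact: saB px.1 (saM px.1 px.1 erefl).
rewrite !opE rdotBl subr_ge0 (px.1 (x v) v); exact: sqnorm_le.
Qed.

(** For [0 <= y <= 1], the increasing iteration [r := (1 - y + r^2) / 2] from
    [0] converges to a solution of [(1 - r)^2 = y]. Its increments are
    polynomials in [1 - y] with nonnegative coefficients. *)
Section SquareRoot.
Variable y : op hM.
Hypotheses (py : pos y) (qy : pos (1 - y)).

Fixpoint sqrt_seq n : op hM :=
  if n is m.+1 then 2^-1 *: (1 - y + sqrt_seq m * sqrt_seq m) else 0.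

Lemma sqrt_seqS n :
  sqrt_seq n.+1 = 2^-1 *: (1 - y + sqrt_seq n * sqrt_seq n).
Proof. by []. Qed.

Lemma sqrt_seq_cone n : poly_cone (1 - y) (sqrt_seq n).
Proof.
elim: n => [|n ih] /=; first exact: poly_cone0.
apply: poly_coneZ; first by rewrite invr_ge0.
by apply: poly_coneD; [exact: poly_cone_gen|exact: poly_coneM].
Qed.

Lemma sqrt_seq_incr n : poly_cone (1 - y) (sqrt_seq n.+1 - sqrt_seq n).
Proof.
elim: n => [|n ih].
  rewrite /= mulr0 addr0 subr0; apply: poly_coneZ; last exact: poly_cone_gen.
  by rewrite invr_ge0.
have cc : sqrt_seq n * sqrt_seq n.+1 = sqrt_seq n.+1 * sqrt_seq n.
  apply: poly_cone_comm (sqrt_seq_cone n.+1); apply/esym.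
  exact: poly_cone_comm (sqrt_seq_cone n).
rewrite (sqrt_seqS n.+1) {3}(sqrt_seqS n) -scalerBr opprD addrACA subrr add0r.
have -> : sqrt_seq n.+1 * sqrt_seq n.+1 - sqrt_seq n * sqrt_seq n =
    (sqrt_seq n.+1 - sqrt_seq n) * (sqrt_seq n.+1 + sqrt_seq n).
  by rewrite mulrBl !mulrDr cc opprD addrA addrK.
apply: poly_coneZ; first by rewrite invr_ge0.
apply: poly_coneM => //; apply: poly_coneD; exact: sqrt_seq_cone.
Qed.

Lemma sqrt_seq_le1 n : pos (1 - sqrt_seq n).
Proof.
elim: n => [|n ih]; first by rewrite subr0; exact: pos1.
have pn : pos (sqrt_seq n) := poly_cone_pos qy (sqrt_seq_cone n).
have -> : 1 - sqrt_seq n.+1 = 2^-1 *: (y + ((1 - sqrt_seq n) +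
    (sqrt_seq n - sqrt_seq n * sqrt_seq n))).
  rewrite sqrt_seqS; move: (sqrt_seq n) => w.
  have -> : 1 - w + (w - w * w) = 1 - w * w by rewrite addrA subrK.
  apply/eqP; rewrite subr_eq -scalerDr addrACA subrK [y + _]addrC subrK.
  have -> : 1 + 1 = (2 : R) *: (1 : op hM) by rewrite scaler_nat mulr2n.
  by rewrite scalerA mulVf ?scale1r // pnatr_eq0.
apply: posZ; first by rewrite invr_ge0.
by apply: posD => //; apply: posD => //; exact: pos_sub_sqr.
Qed.

Lemma sqrt_exists01 : exists x, [/\ pos x, x * x = y &
  forall c, c * y = y * c -> c * x = x * c].
Proof.
have pn n : pos (sqrt_seq n) := poly_cone_pos qy (sqrt_seq_cone n).
have [|x ux] := vigier hH pn sqrt_seq_le1.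
  by move=> n; exact: poly_cone_pos (sqrt_seq_incr n).
have ex : x = 2^-1 *: (1 - y + x * x).
  apply: (strong_lim_unique (strong_lim_shift ux)) => /=.
  apply: (@strong_limZ _ _ _ _ _ _ (fun n => 1 - y + sqrt_seq n * sqrt_seq n)).
  apply: (@strong_limD _ _ _ _ _ (fun=> 1 - y)
    (fun n => sqrt_seq n * sqrt_seq n)).
    exact: strong_lim_cst.
  exact: strong_lim_sqr sqrt_seq_le1 ux.
have e2 : x + x = 1 - y + x * x.
  by rewrite {1 2}ex -scalerDl -[2^-1]div1r -splitr scale1r.
exists (1 - x); split.
- apply: (@strong_lim_pos _ _ _ _ hH _ (fun n => 1 - sqrt_seq n)).
    apply: (@strong_limD _ _ _ _ _ (fun=> 1)); first exact: strong_lim_cst.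
    exact: strong_limN.
  exact: sqrt_seq_le1.
- have exx : x * x = x + x - (1 - y) by rewrite e2 addrAC subrr add0r.
  rewrite mulrBl mul1r mulrBr mulr1 exx opprB [x + x - _ - x]addrAC addrK.
  by rewrite addrA subrK opprB addrC subrK.
- move=> c cy; apply: commrB; first exact: commr1.
  apply: (strong_lim_comm ux) => n; apply: poly_cone_comm (sqrt_seq_cone n).
  by apply: commrB => //; exact: commr1.
Qed.

End SquareRoot.

Lemma sqrt_exists y : pos y -> exists x, [/\ pos x, x * x = y &
  forall c, c * y = y * c -> c * x = x * c].
Proof.
move=> py; have [K K0 [qy _]] := sa_bounded hH py.1.
have iK : 0 <= K^-1 by rewrite invr_ge0 ltW.
have [||x [px xx cx]] := @sqrt_exists01 (K^-1 *: y).
- exact: posZ.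
- have -> : 1 - K^-1 *: y = K^-1 *: (K *: (1 : op hM) - y).
    by rewrite scalerBr scalerA mulVf ?gt_eqF // scale1r.
  exact: posZ.
exists (Num.sqrt K *: x); split.
- by apply: posZ => //; exact: sqrtr_ge0.
- rewrite -op_scalerAl -op_scalerAr xx !scalerA -expr2 sqr_sqrtr ?ltW //.
  by rewrite divff ?gt_eqF // scale1r.
- by move=> c cy; apply: op_commZ; apply: cx; exact: op_commZ.
Qed.

(** After scaling, [0 <= y^2 <= 1] and [1 - (1 - y^2)^n] increases to the
    projection [e] onto the closure of the range of [y]. The last clause says
    that [z] vanishes on this closure if it vanishes on the range; applied to
    [z = 1 - e] it shows that [e] is idempotent. *)
Lemma support_projection y : sa y -> exists e, [/\ sa e, e * e = e, y * e = y,
  (forall c, c * y = y * c -> c * e = e * c) &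
  forall z, z * y = 0 -> z * e = 0].
Proof.
move=> sy; have syy := pos_sqr hH sy.
have [K K0 [qy _]] := sa_bounded hH syy.1.
have iK : 0 <= K^-1 by rewrite invr_ge0 ltW.
pose g := 1 - K^-1 *: (y * y).
have pg : pos g.
  rewrite /g.
  have -> : 1 - K^-1 *: (y * y) = K^-1 *: (K *: (1 : op hM) - (y * y)).
    by rewrite scalerBr scalerA mulVf ?gt_eqF // scale1r.
  exact: posZ.
have cg c : c * y = y * c -> c * g = g * c.
  move=> cy; apply: commrB; first exact: commr1.
  by apply: op_commZ; exact: commrM.
pose u n := 1 - g ^+ n.
have du n : u n.+1 - u n = K^-1 *: (y * g ^+ n * y).
  rewrite /u opprB addrCA [1 - _ - 1]addrAC subrr add0r exprS.
  rewrite -[X in X - _]mul1r -mulrBl {1}/g opprB addrC subrK.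
  rewrite -op_scalerAl; congr (_ *: _).
  rewrite -!mulrA; congr (_ * _); exact/commrX/cg.
have pu n : pos (u n).
  elim: n => [|n ih]; first by rewrite /u expr0 subrr; exact: pos0.
  rewrite -(subrK (u n) (u n.+1)); apply: posD => //; rewrite du.
  by apply: posZ => //; apply: pos_conj => //; exact: posX.
have qu n : pos (1 - u n) by rewrite /u opprB addrC subrK; exact: posX.
have [|e ue] := vigier hH pu qu.
  move=> n; rewrite du; apply: posZ => //.
  by apply: pos_conj => //; exact: posX.
have se : sa e by apply: strong_lim_sa ue _ => // n; exact: (pu n).1.
have ce c : c * y = y * c -> c * e = e * c.
  move=> cy; apply: (strong_lim_comm ue) => n.
  by apply: commrB; [exact: commr1|apply: commrX; exact: cg].
have ze z : z * y = 0 -> z * e = 0.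
  move=> zy; have zg n : z * g ^+ n = z.
    elim: n => [|n ih]; first by rewrite mulr1.
    rewrite exprSr mulrA ih mulrBr mulr1 -op_scalerAr mulrA zy.
    by rewrite mul0r scaler0 subr0.
  have zu : (fun n => z * u n) = (fun=> 0).
    by apply/funext => n; rewrite /u mulrBr mulr1 zg subrr.
  have := strong_lim_mull (z := z) ue; rewrite zu => h.
  exact: strong_lim_unique h (@strong_lim_cst _ _ _ _ _ 0).
have ge : 1 - e = g * (1 - e).
  apply: (@strong_lim_unique _ _ _ _ _ (fun n => g ^+ n.+1)).
    have -> : (fun n => g ^+ n.+1) = (fun n => 1 - u n.+1).
      by apply/funext => n; rewrite /u opprB addrC subrK.
    apply: (@strong_limD _ _ _ _ _ (fun=> 1)); first exact: strong_lim_cst.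
    apply: (@strong_limN _ _ _ _ _ (fun n => u n.+1)).
    exact: strong_lim_shift.
  have -> : (fun n => g ^+ n.+1) = (fun n => g * (1 - u n)).
    by apply/funext => n; rewrite /u opprB addrC subrK exprS.
  apply: strong_lim_mull; apply: (@strong_limD _ _ _ _ _ (fun=> 1)).
    exact: strong_lim_cst.
  exact: strong_limN.
have ye0 : y * y * (1 - e) = 0.
  move: ge; rewrite {1}/g mulrBl mul1r => /eqP.
  rewrite eq_sym -subr_eq0 addrAC subrr add0r oppr_eq0 -op_scalerAl => /eqP h.
  by rewrite -[LHS]scale1r -(@mulfV _ K) ?gt_eqF // -scalerA h scaler0.
have cye : y * (1 - e) = (1 - e) * y.
  by apply: commrB; [exact: commr1|exact: ce].
(* [y (1 - e)] is self-adjoint, since its factors commute, with square 0. *)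
have yq : y * (1 - e) = 0.
  apply: (sa_sqr_eq0 hH); first by apply: saM => //; exact: saB.
  by rewrite {1}cye -mulrA [y * (y * _)]mulrA ye0 mulr0.
exists e; split=> //.
- apply/eqP; rewrite -subr_eq0 -[X in _ - X]mul1r -mulrBl -oppr_eq0.
  by rewrite -mulNr opprB ze // -cye.
- by apply/eqP; rewrite eq_sym -subr_eq0 -{1}[y]mulr1 -mulrBr yq.
Qed.

(** [p] is the spectral projection of [d] for the open half line of negative
    numbers: the fourth clause splits [d] into a negative and a positive part,
    and the last one says that the range of [p] meets the kernel of [d]
    trivially. *)
Definition negative_projection d p :=
  [/\ sa p, p * p = p, d * p = p * d, pos (- (d * p)) /\ pos (d * (1 - p)) &
      forall z, z * (d * p) = 0 -> z * p = 0].

(** With [m = |d|], the support [p] of [m - d] is annihilated by [m + d], since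
    [(m + d) (m - d) = 0]. So [d = - m] on the range of [p], while [d = m] on
    the kernel of [p]. *)
Lemma negative_projection_exists d : sa d -> exists p, negative_projection d p.
Proof.
move=> sd; have [m [pm mm cm]] := sqrt_exists (pos_sqr hH sd).
have md : m * d = d * m by apply/esym/cm; rewrite mulrA.
have [p [sp pp yp cp zp]] := support_projection (saB pm.1 sd).
have dp : d * p = p * d by apply: cp; rewrite mulrBr mulrBl md.
have mp : m * p = p * m by apply: cp; rewrite mulrBr mulrBl md.
have e1 : m * p = - (d * p).
  apply/eqP; rewrite -addr_eq0 -mulrDl; apply/eqP/zp.
  by rewrite mulrDl !mulrBr mm md addrA subrK subrr.
have e2 : (m - d) * (1 - p) = 0 by rewrite mulrBr mulr1 yp subrr.
have e3 : d * (1 - p) = m * (1 - p).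
  by apply/eqP; rewrite eq_sym -subr_eq0 -mulrBl e2.
have qq : (1 - p) * (1 - p) = 1 - p.
  by rewrite mulrBr mulr1 mulrBl mul1r pp subrr subr0.
have cq : m * (1 - p) = (1 - p) * m by apply: commrB => //; exact: commr1.
exists p; split=> //.
- split; first by rewrite -e1 -pp mulrA mp; exact: pos_conj.
  by rewrite e3 -qq mulrA cq; apply: pos_conj => //; exact: saB.
- move=> z h; apply: zp.
  have -> : m - d = - (d * p + d * p) .
    by rewrite opprD -{1}e1 -mulrBl yp.
  by rewrite mulrN mulrDr h addr0 oppr0.
Qed.

End FunctionalCalculus.

(** * The trace and its minimisers *)
Section Trace.
Variables (R : realType) (H : completeNormedModType R[i]).
Variables (dot : inner_product H) (M : set (H -> H)).
Variable tau : (H -> H) -> R[i].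
Hypothesis hH : induces_norm dot.
Variable hM : von_neumann_algebra dot M.
Hypothesis htau : faithful_normal_tracial_state dot M tau.
Implicit Types (a b c d e h k p q x y z : op hM) (s : R).

Local Notation rd := (rdot dot).

Definition retr x : R := complex.Re (tau x).

Lemma self_adjoint_sa x : self_adjoint dot x <-> sa x.
Proof.
split=> [sx u v|sx]; first by rewrite /rdot sx.
by apply: real_self_adjoint sx; exact: op_linear.
Qed.

(** Links the order of operators, defined by complex positivity, with [pos]. *)
Lemma op_le_pos x y : op_le dot x y <-> pos (y - x).
Proof.
split=> [le|[sx px] v].
  have s : sa (y - x).
    by apply/self_adjoint_sa/positive_self_adjoint => //; exact: op_linear.
  by split=> // v; have := le v; rewrite lecE => /andP[].
have := px v; rewrite lecE => rp; apply/andP; split=> //.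
have /self_adjoint_sa s := sx; have := s v v; rewrite [RHS]dotC.
rewrite -[y v - x v]/((y - x) v).
by case: (dot _ v) => r i /= [] i0; apply/eqP; lra.
Qed.

Lemma retrD x y : retr (x + y) = retr x + retr y.
Proof.
have := tau_lin htau 1 (opP x) (opP y); rewrite scale1r mul1r => e.
by rewrite /retr [tau _]e raddfD.
Qed.

Lemma retr0 : retr 0 = 0.
Proof. by apply: (addrI (retr 0)); rewrite -retrD !addr0. Qed.

Lemma retrZ r x : retr (r *: x) = r * retr x.
Proof.
have := tau_lin htau r%:C (opP x) (opP (0 : op hM)); rewrite addr0 => e.
rewrite /retr [tau _]e raddfD /= Re_scale -[X in _ + X]/(retr 0) retr0 addr0 //.
Qed.

Lemma retrN x : retr (- x) = - retr x.
Proof. by rewrite -scaleN1r retrZ mulN1r. Qed.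

Lemma retrB x y : retr (x - y) = retr x - retr y.
Proof. by rewrite retrD retrN. Qed.

Lemma retr1 : retr 1 = 1.
Proof. by rewrite /retr [tau _](tau_one htau). Qed.

Lemma retrC x y : retr (x * y) = retr (y * x).
Proof.
by rewrite /retr; congr complex.Re; apply: (tau_tracial htau); exact: opP.
Qed.

Lemma pos_op_le x : pos x -> op_le dot 0 x.
Proof. by move=> px; apply/(op_le_pos 0); rewrite subr0. Qed.

Lemma retr_ge0 x : pos x -> 0 <= retr x.
Proof.
move=> /pos_op_le px; have := tau_ge0 htau (opP x) px.
by rewrite lecE => /andP[].
Qed.

Lemma retr_faithful x : pos x -> retr x = 0 -> x = 0.
Proof.
move=> /pos_op_le px tx; apply: op_ext => v.
have := tau_ge0 htau (opP x) px; rewrite lecE => /andP[/eqP ix _].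
rewrite (tau_faithful htau (opP x) px) //.
by apply/eqP; rewrite eq_complex /= ix -/(retr x) tx !eqxx.
Qed.

(** With [h = r^2], the trace of [h k] is that of the positive operator
    [r k r]. *)
Lemma retr_mul_ge0 h k : pos h -> pos k -> 0 <= retr (h * k).
Proof.
move=> ph pk; have [r [pr <- _]] := sqrt_exists hH ph.
by rewrite -mulrA retrC; apply/retr_ge0/pos_conj => //; exact: pr.1.
Qed.

Lemma retr_mul_eq0 h k : pos h -> pos k -> pos (1 - k) -> retr (h * k) = 0 ->
  k * h = 0.
Proof.
move=> ph pk qk; have [r [pr <- _]] := sqrt_exists hH ph.
rewrite -mulrA retrC => /(retr_faithful (pos_conj pr.1 pk)).
by move=> /(pos_conj_eq0 hH pr.1 pk qk) kr; rewrite mulrA kr mul0r.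
Qed.

Lemma pos_proj p : sa p -> p * p = p -> pos p.
Proof. by move=> sp pp; rewrite -pp; exact: pos_sqr. Qed.

Lemma proj_compl p : p * p = p -> (1 - p) * (1 - p) = 1 - p.
Proof. by move=> pp; rewrite mulrBr mulr1 mulrBl mul1r pp subrr subr0. Qed.

Lemma pos_compl p : sa p -> p * p = p -> pos (1 - p).
Proof. by move=> sp pp; apply: pos_proj; [exact: saB|exact: proj_compl]. Qed.

(** In the splitting of [d x - d p], both terms are products of two positive
    operators. If their traces vanish, then [x p = p], so that [x - p] is the
    positive operator [(1 - p) x (1 - p)]. *)
Section Minimiser.
Variables d p x : op hM.
Hypotheses (np : negative_projection d p) (px : pos x) (qx : pos (1 - x)).

Lemma negative_projection_split :
  d * x - d * p = d * (1 - p) * x + - (d * p) * (1 - x).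
Proof.
rewrite [- _ * (1 - x)]mulrBr mulr1 !mulNr opprK addrA.
by rewrite [RHS]addrAC -mulrDl -mulrDr subrK mulr1.
Qed.

Lemma negative_projection_min : retr (d * p) <= retr (d * x).
Proof.
case: np => sp pp dp [n1 n2] _.
rewrite -subr_ge0 -retrB negative_projection_split retrD.
by apply: addr_ge0; exact: retr_mul_ge0.
Qed.

Lemma negative_projection_face : retr (d * x) = retr (d * p) ->
  retr p <= retr x /\ (retr x = retr p -> x = p).
Proof.
case: np => sp pp dp [n1 n2] st e.
have h0 : retr (- (d * p) * (1 - x)) = 0.
  have := retr_mul_ge0 n1 qx; have := retr_mul_ge0 n2 px.
  have : retr (d * x - d * p) = 0 by rewrite retrB e subrr.
  rewrite negative_projection_split retrD; lra.
have xp : x * p = p.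
  have /(retr_mul_eq0 n1 qx) : retr (- (d * p) * (1 - x)) = 0 by [].
  rewrite opprB addrC subrK => /(_ px) /eqP; rewrite mulrN oppr_eq0 => /eqP.
  by move=> /st; rewrite mulrBl mul1r => /eqP; rewrite subr_eq0 => /eqP.
have pxp : p * x = p.
  apply: op_ext => v; apply: (rdot_inj hH) => w.
  by rewrite opME sp px.1 -opME xp sp.
have ex : (1 - p) * x * (1 - p) = x - p.
  by rewrite mulrBl mul1r pxp mulrBr mulr1 mulrBl xp pp subrr subr0.
have pxp' : pos (x - p) by rewrite -ex; apply: pos_conj => //; exact: saB.
split; first by rewrite -subr_ge0 -retrB; exact: retr_ge0.
move=> txp; apply/eqP; rewrite -subr_eq0; apply/eqP/retr_faithful => //.
by rewrite retrB txp subrr.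
Qed.

End Minimiser.

End Trace.

(** * Operators with commuting spectral projections *)
Section Commutation.
Variables (R : realType) (H : completeNormedModType R[i]).
Variables (dot : inner_product H) (M : set (H -> H)).
Variable tau : (H -> H) -> R[i].
Hypothesis hH : induces_norm dot.
Variable hM : von_neumann_algebra dot M.
Hypothesis htau : faithful_normal_tracial_state dot M tau.
Implicit Types (d h k p q w x y z : op hM) (s : R).

Local Notation rd := (rdot dot).
Local Notation retr := (@retr R H dot M tau hM).

Definition skew w := forall u v, rd (w u) v = - rd u (w v).

Lemma skew_commutator_sa w c : skew w -> sa c -> sa (w * c - c * w).
Proof.
move=> sw sc u v; rewrite !opE !(rdotBl, rdotBr) !(sw, sc); lra.
Qed.

Lemma skew_sqr_pos w : skew w -> pos (- (w * w)).
Proof.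
move=> sw; split=> [u v|v]; first by rewrite !opE rdotNl rdotNr !sw opprK.
by rewrite !opE rdotNl sw opprK; exact: rdot_ge0.
Qed.

(** One factor of [w w] is expanded and the trace property moves [c] to the
    other side. The first factor on the right does not mention [d], so it stays
    fixed while [d] and [q] range over the pieces of a partition. *)
Lemma retr_sqr_commutator w c d q : w = d * c - c * d -> c * q = q * c ->
  retr (- (w * w) * q) = retr ((w * c - c * w) * (d * q)).
Proof.
move=> ew cq; rewrite {2}ew -mulrN opprB mulrBr !mulrBl !retrB //.
congr (_ - _).
by rewrite -[w * _ * q]mulrA -[d * c * q]mulrA cq !mulrA retrC // !mulrA.
Qed.

Variables (a c : op hM) (P : R -> op hM).
Hypotheses (sa_a : sa a) (sa_c : sa c).
Hypothesis hP : forall s, negative_projection (a - s *: (1 : op hM)) (P s).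
Hypothesis comm_c_proj : forall s, c * P s = P s * c.

Let D s : op hM := a - s *: (1 : op hM).

Lemma comm_a_proj s : a * P s = P s * a.
Proof.
case: (hP s) => _ _ h _ _; move: h; rewrite mulrBl mulrBr.
by rewrite -op_scalerAl -op_scalerAr mul1r mulr1 => /addIr.
Qed.

Lemma comm_shift_proj s s' : D s * P s' = P s' * D s.
Proof.
apply/esym/commrB; first exact/esym/comm_a_proj.
by apply: op_commZ; exact: commr1.
Qed.

Lemma shiftD s r : D (s + r) = D s - r *: (1 : op hM).
Proof. by rewrite /D scalerDl opprD addrA. Qed.

(** By the trace property, [D s] is at once at most [0] and at least [r] when
    tested against [P s] and [1 - P (s + r)]; so the product of these two
    projections vanishes. *)
Lemma neg_proj_mono s r : 0 < r ->
  P s * P (s + r) = P s /\ P (s + r) * P s = P s.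
Proof.
move=> r0; case: (hP s) => sp pp _ [n1 n2] _.
case: (hP (s + r)) => sp' pp' _ [n1' n2'] _.
rewrite -!/(D _) in n1 n2 n1' n2'.
set p := P s in sp pp n1 n2 *; set p' := P (s + r) in sp' pp' n1' n2' *.
have pq : pos (1 - p') by exact: pos_compl.
have e0 : retr ((1 - p') * p) = 0.
  have h0 : retr ((1 - p') * p * (1 - p')) = retr ((1 - p') * p).
    by rewrite retrC // mulrA proj_compl.
  have h1 : 0 <= retr ((1 - p') * p).
    rewrite -h0; apply: retr_ge0 => //.
    by apply: pos_conj; [exact: pq.1|exact: pos_proj].
  have h2 := retr_mul_ge0 hH htau n1 pq.
  have h3 := retr_mul_ge0 hH htau n2' (pos_proj hH sp pp).
  have h4 : retr (D (s + r) * (1 - p') * p) =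
      retr (D s * p * (1 - p')) - r * retr ((1 - p') * p).
    rewrite shiftD mulrBl mulrBl retrB // -op_scalerAl mul1r -op_scalerAl.
    rewrite retrZ //.
    have -> : D s * (1 - p') = (1 - p') * D s.
      by apply: commrB; [exact: commr1|exact: comm_shift_proj].
    by congr (_ - _); rewrite -[(1 - p') * _ * p]mulrA retrC.
  rewrite mulNr retrN // in h2.
  rewrite h4 in h3; apply/eqP; rewrite eq_le h1 andbT -(pmulr_rle0 _ r0); lra.
have z1 : p * (1 - p') * p = 0.
  apply: (retr_faithful htau); first by apply: pos_conj.
  by rewrite -mulrA retrC // -mulrA pp.
have z2 : (1 - p') * p = 0.
  apply: (pos_conj_eq0 hH sp pq) => //; rewrite opprB addrC subrK.
  exact: pos_proj.
have e1 : p' * p = p.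
  by move/eqP: z2; rewrite mulrBl mul1r subr_eq0 eq_sym => /eqP.
split=> //; apply: op_ext => v; apply: (rdot_inj hH) => u.
by rewrite opME sp sp' -opME e1 sp.
Qed.

Let w : op hM := a * c - c * a.
Let f : op hM := w * c - c * w.

Lemma comm_w_proj s : w * P s = P s * w.
Proof.
apply/esym; have h1 := esym (comm_a_proj s); have h2 := esym (comm_c_proj s).
by apply: commrB; apply: commrM.
Qed.

Lemma commutator_skew : skew w.
Proof.
by move=> u v; rewrite /w !opE !(rdotBl, rdotBr) !(sa_a, sa_c) opprB.
Qed.

Lemma double_commutator_sa : sa f.
Proof. exact: skew_commutator_sa commutator_skew sa_c. Qed.

Lemma sqr_commutator_pos : pos (- (w * w)).
Proof. exact: skew_sqr_pos commutator_skew. Qed.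

(** The projection [q = P (s + r) - P s] satisfies [0 <= D s q <= r q]; the
    trace of [- w^2 q] is that of [f (D s q)], at most [K] times that of
    [D s q]. *)
Lemma retr_step K s r : 0 <= K -> pos (K *: (1 : op hM) - f) -> 0 < r ->
  retr (- (w * w) * P (s + r)) - retr (- (w * w) * P s) <=
  K * r * (retr (P (s + r)) - retr (P s)).
Proof.
move=> K0 Kf r0; have [e1 e2] := neg_proj_mono s r0.
case: (hP s) => sp pp _ [n1 n2] _; case: (hP (s + r)) => sp' pp' _ [n1' n2'] _.
rewrite -!/(D _) in n1 n2 n1' n2'.
rewrite -!retrB // -mulrBr.
have [q qE] : exists q, q = P (s + r) - P s by eexists.
rewrite -qE.
have sq : sa q by rewrite qE; exact: saB.
have qq : q * q = q by rewrite qE mulrBl !mulrBr pp' e1 e2 pp subrr subr0.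
have dq : D s * q = q * D s.
  by rewrite qE; apply: commrB; exact: comm_shift_proj.
have wq : w * q = q * w by rewrite qE; apply: commrB; exact: comm_w_proj.
have cq : c * q = q * c by rewrite qE; apply: commrB; exact: comm_c_proj.
have p1 : pos (D s * q).
  have -> : D s * q = q * (D s * (1 - P s)) * q; last by exact: pos_conj.
  have e : (1 - P s) * q = q.
    by rewrite mulrBl mul1r qE mulrBr e1 pp subrr subr0.
  by rewrite -!mulrA e mulrA -dq -mulrA qq.
have p2 : pos (r *: q - D s * q).
  have -> : r *: q - D s * q = q * (- (D (s + r) * P (s + r))) * q;
    last by exact: pos_conj.
  have e : P (s + r) * q = q by rewrite qE mulrBr pp' e2.
  rewrite mulrN mulNr -!mulrA e shiftD [(D s - _) * q]mulrBl.
  rewrite [q * (_ - _)]mulrBr.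
  by rewrite -op_scalerAl mul1r -op_scalerAr qq dq mulrA qq opprB.
have hw : w = D s * c - c * D s.
  rewrite /D mulrBl mulrBr -op_scalerAl -op_scalerAr mul1r mulr1.
  by rewrite opprB addrA subrK.
rewrite (retr_sqr_commutator hw cq) -/f.
have h1 := retr_mul_ge0 hH htau Kf p1; have h2 := retr_ge0 htau p2.
rewrite mulrBl retrB // -op_scalerAl mul1r retrZ // in h1.
rewrite retrB // retrZ // in h2.
have h3 : K * retr (D s * q) <= K * (r * retr q).
  by apply: ler_wpM2l => //; rewrite -subr_ge0.
lra.
Qed.

Lemma retr_steps K s r n : 0 <= K -> pos (K *: (1 : op hM) - f) -> 0 < r ->
  retr (- (w * w) * P (s + r *+ n)) - retr (- (w * w) * P s) <=
  K * r * (retr (P (s + r *+ n)) - retr (P s)).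
Proof.
move=> K0 Kf r0; elim: n => [|n ih]; first by rewrite mulr0n addr0 !subrr mulr0.
have := retr_step (s + r *+ n) K0 Kf r0.
by rewrite -addrA -mulrSr; lra.
Qed.

Lemma neg_proj_low K : pos (K *: (1 : op hM) + a) -> P (- (K + 1)) = 0.
Proof.
move=> Ka; case: (hP (- (K + 1))) => sp pp _ [n1 _] _.
have pP := pos_proj hH sp pp.
have h1 := retr_ge0 htau n1; have h2 := retr_mul_ge0 hH htau Ka pP.
apply: (retr_faithful htau) => //; apply/eqP; rewrite eq_le retr_ge0 // andbT.
move: h1 h2; rewrite retrN // mulrBl retrB // mulrDl retrD //.
rewrite -!op_scalerAl !mul1r !retrZ //; lra.
Qed.

Lemma neg_proj_high K : pos (K *: (1 : op hM) - a) -> P (K + 1) = 1.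
Proof.
move=> Ka; case: (hP (K + 1)) => sp pp _ [_ n2] _.
have pq := pos_compl hH sp pp.
have h1 := retr_ge0 htau n2; have h2 := retr_mul_ge0 hH htau Ka pq.
apply/esym/eqP; rewrite -subr_eq0; apply/eqP/(retr_faithful htau) => //.
apply/eqP; rewrite eq_le retr_ge0 // andbT.
move: h1 h2; move: (1 - P (K + 1)) => q; rewrite !mulrBl !retrB //.
rewrite -!op_scalerAl !mul1r !retrZ //; lra.
Qed.

(** [P] increases from [0] to [1] between [- (L + 1)] and [L + 1]. Cutting this
    interval into [n.+1] pieces bounds the trace of [- w^2] by a multiple of
    [1 / n.+1]. *)
Lemma commute_of_neg_proj : a * c = c * a.
Proof.
have [K K0 [Kf _]] := sa_bounded hH double_commutator_sa.
have [L L0 [La1 La2]] := sa_bounded hH sa_a.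
have key n : retr (- (w * w)) <= K * ((L + 1) *+ 2 / n.+1%:R).
  have n0 : (0 : R) < n.+1%:R by rewrite ltr0Sn.
  have r0 : 0 < (L + 1) *+ 2 / n.+1%:R.
    by rewrite divr_gt0 // mulrn_wgt0 // addr_gt0.
  have := retr_steps (- (L + 1)) n.+1 (ltW K0) Kf r0.
  have -> : - (L + 1) + ((L + 1) *+ 2 / n.+1%:R) *+ n.+1 = L + 1.
    rewrite -[_ *+ n.+1]mulr_natr divfK ?gt_eqF //; lra.
  rewrite neg_proj_low // neg_proj_high // mulr1 mulr0 retr0 // retr1 //.
  by rewrite !subr0 mulr1.
have w0 : retr (- (w * w)) <= 0.
  rewrite leNgt; apply/negP => t0.
  have C0 : 0 <= K * ((L + 1) *+ 2) / retr (- (w * w)).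
    rewrite divr_ge0 ?(ltW t0) // mulr_ge0 ?(ltW K0) // mulrn_wge0 //.
    by rewrite addr_ge0 ?(ltW L0).
  have := key (Num.bound (K * ((L + 1) *+ 2) / retr (- (w * w)))).
  have := archi_boundP C0; move: (Num.bound _) => m.
  rewrite ltr_pdivrMr // => h1; rewrite mulrA ler_pdivlMr ?ltr0Sn // -natr1.
  lra.
have ww : - (w * w) = 0.
  apply: (retr_faithful htau sqr_commutator_pos); apply/eqP.
  by rewrite eq_le w0 retr_ge0 //; exact: sqr_commutator_pos.
apply/eqP; rewrite -subr_eq0; apply/eqP; rewrite -/w.
apply: op_ext => v; apply: (rdot_eq0 hH).
rewrite commutator_skew -rdotNr -[- w (w v)]/((- (w * w)) v) ww.
by rewrite /rdot linear0r.
Qed.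

End Commutation.

(** * Extreme points of the spectral scale *)
Lemma sub_pencil (V : zmodType) (x y y' z z' : V) :
  (x + y - z) - (x + y' - z') + (z - z') = y - y'.
Proof.
rewrite opprB addrACA subrK [z' - _ - z']addrAC subrr add0r.
by rewrite opprD addrACA subrr add0r.
Qed.

Section SpectralScale.
Variables (R : realType) (H : completeNormedModType R[i]).
Variables (dot : inner_product H) (M : set (H -> H)).
Variable tau : (H -> H) -> R[i].
Hypothesis hH : induces_norm dot.
Variable hM : von_neumann_algebra dot M.
Hypothesis htau : faithful_normal_tracial_state dot M tau.
Implicit Types (d p x y z : op hM) (s t th : R).

Local Notation retr := (@retr R H dot M tau hM).

Variables (n : nat) (b : 'I_n -> op hM).
Hypothesis sb : forall i, sa (b i).

Local Notation Psi x := (scale_map tau (fun i => b i : H -> H) (x : op hM)).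
Local Notation B := (spectral_scale dot M tau (fun i => b i : H -> H)).

Lemma scale_map_trace x : Psi x 0 (lshift n 0) = retr x.
Proof. by rewrite /scale_map row_mxEl mxE eqxx. Qed.

Lemma scale_map_coord x i : Psi x 0 (rshift 1 i) = retr (b i * x).
Proof. by rewrite /scale_map row_mxEr mxE. Qed.

Lemma spectral_scaleP v :
  B v -> exists x, [/\ pos x, pos (1 - x) & v = Psi x].
Proof.
move=> [x [Mx x0 x1] <-]; exists (Op hM Mx); split=> //.
- by have /op_le_pos := x0 : op_le dot (0 : op hM) (Op hM Mx); rewrite subr0.
- by have /op_le_pos := x1 : op_le dot (Op hM Mx) (1 : op hM).
Qed.

Lemma spectral_scale_mem x : pos x -> pos (1 - x) -> B (Psi x).
Proof.
move=> px qx; exists x => //; split; first exact: opP.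
- exact: pos_op_le.
- exact/(op_le_pos x 1).
Qed.

Section Pencil.
Variables i j : 'I_n.

Definition pencil th s : op hM := b i + th *: b j - s *: (1 : op hM).

Lemma pencil_sa th s : sa (pencil th s).
Proof. by apply: saB; [apply: saD => //; exact: saZ|exact: saZ]. Qed.

Definition pencil_coord th s (v : 'rV[R]_(1 + n)) : R :=
  v 0 (rshift 1 i) + th * v 0 (rshift 1 j) - s * v 0 (lshift n 0).

Lemma pencil_coordE th s x : pencil_coord th s (Psi x) = retr (pencil th s * x).
Proof.
rewrite /pencil_coord !scale_map_coord scale_map_trace /pencil.
by rewrite mulrBl mulrDl retrB // retrD // -!op_scalerAl mul1r !retrZ.
Qed.

Variables (p : op hM) (th s : R).
Hypothesis np : negative_projection (pencil th s) p.

Lemma scale_map_inj x : pos x -> pos (1 - x) -> Psi x = Psi p -> x = p.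
Proof.
move=> px qx e.
have [_] : retr p <= retr x /\ (retr x = retr p -> x = p).
  apply: (negative_projection_face hH htau np) => //.
  by rewrite -!pencil_coordE e.
by apply; rewrite -!scale_map_trace e.
Qed.

Lemma scale_map_extreme : extreme_points B (Psi p).
Proof.
have [sp pp _ _ _] := np.
split; first by apply: spectral_scale_mem; [exact: pos_proj|exact: pos_compl].
move=> _ _ t /spectral_scaleP[y [py qy ->]] /spectral_scaleP[z [pz qz ->]].
move=> /andP[t0 t1] e.
have e1 : retr (pencil th s * p) =
    t * retr (pencil th s * y) + (1 - t) * retr (pencil th s * z).
  by rewrite -!pencil_coordE e /pencil_coord !mxE; ring.
have e2 : retr p = t * retr y + (1 - t) * retr z.
  by rewrite -!scale_map_trace e !mxE.
have my := negative_projection_min hH htau np py qy.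
have mz := negative_projection_min hH htau np pz qz.
have [ey ez] : retr (pencil th s * y) = retr (pencil th s * p) /\
    retr (pencil th s * z) = retr (pencil th s * p) by split; nra.
have [ly y_p] := negative_projection_face hH htau np py qy ey.
have [lz z_p] := negative_projection_face hH htau np pz qz ez.
by rewrite y_p 1?z_p //; nra.
Qed.

End Pencil.

Hypothesis hB : countable (extreme_points B).

Lemma uncountable_real : ~ countable [set: R].
Proof.
move=> cR.
have c01 : countable (`[0, 1]%classic : set R).
  by apply: sub_countable cR; exact: subset_card_le.
have := countable_lebesgue_measure0 c01.
rewrite lebesgue_measure_itv /= lte_fin ltr01 sube0 => /eqP.
by rewrite eqe oner_eq0.
Qed.

(** If every [b i + th *: b j] had a spectral projection that does not commute
    with [b j], the images of these projections in the scale would be uncountably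
    many distinct extreme points. *)
Lemma generators_commute i j : b i * b j = b j * b i.
Proof.
have ex th s : {p | negative_projection (pencil i j th s) p}.
  by apply: cid; apply: negative_projection_exists => //; exact: pencil_sa.
pose p th s : op hM := sval (ex th s).
have pP th s : negative_projection (pencil i j th s) (p th s).
  exact: svalP (ex th s).
(* [th] is good if every [p th s] commutes with [b j]. *)
have [[th good]|bad] :=
    pselect (exists th, forall s, b j * p th s = p th s * b j).
  have := @commute_of_neg_proj _ _ _ _ _ hH _ htau
    (b i + th *: b j) (b j) (p th).
  rewrite mulrDl mulrDr -op_scalerAl -op_scalerAr => comm.
  apply: addIr (comm _ _ _ _) => //.
    by apply: saD => //; exact: saZ.
  exact: pP.
exfalso; apply: uncountable_real.
have bad1 th : {s | b j * p th s <> p th s * b j}.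
  apply: cid; apply: contrapT => h; apply: bad; exists th => s.
  by apply: contrapT => hs; apply: h; exists s.
pose s th := sval (bad1 th); pose e th := Psi (p th (s th)).
have einj : {in [set: R] &, injective e}.
  move=> th th' _ _ eq_e; apply: contrapT => /eqP nth.
  have [sp pp _ _ _] := pP th (s th).
  have epp : p th (s th) = p th' (s th').
    apply: (scale_map_inj (pP th' (s th'))) eq_e; first exact: pos_proj.
    exact: pos_compl.
  have cm t u : pencil i j t u * p t u = p t u * pencil i j t u.
    by case: (pP t u).
  apply: (svalP (bad1 th)); rewrite -/(s th).
  have := cm th (s th); have := cm th' (s th'); rewrite -epp /pencil.
  move: (p th (s th)) => q h1 h2.
  have d0 : th - th' != 0 by rewrite subr_eq0.
  have -> : b j = (th - th')^-1 *: (pencil i j th (s th) -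
      pencil i j th' (s th') + (s th - s th') *: (1 : op hM)).
    rewrite /pencil; move: (s th) (s th') => u u'.
    rewrite -[LHS]scale1r -(mulVf d0) -scalerA; congr (_ *: _).
    by rewrite !scalerBl sub_pencil.
  apply/esym/op_commZ/commrD; last by apply/op_commZ/commr1.
  exact: commrB.
apply: sub_countable hB; rewrite -(card_le_eql (inj_card_eq einj)).
apply: subset_card_le => _ [th _ <-].
exact: scale_map_extreme (pP th (s th)).
Qed.

End SpectralScale.

(** * Algebras generated by commuting operators *)
Section Commutant.
Variables (R : realType) (H : completeNormedModType R[i]).
Variables (dot : inner_product H) (M : set (H -> H)).
Hypothesis hH : induces_norm dot.
Hypothesis hM : von_neumann_algebra dot M.

Definition relative_commutant (S : set (H -> H)) : set (H -> H) :=
  [set c | M c /\ forall x, S x -> c \o x = x \o c].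

Lemma dot_inj (u v : H) : (forall w, dot u w = dot v w) -> u = v.
Proof. by move=> uv; apply: (rdot_inj hH) => w; rewrite /rdot uv. Qed.

Lemma adjoint_pair_sym (a c : H -> H) :
  adjoint_pair dot a c -> adjoint_pair dot c a.
Proof. by move=> ac u v; rewrite dotC -ac -dotC. Qed.

(** With the adjoint [y] of [x], commutation with [x] is an equality of two
    matrix coefficients, a closed condition. *)
Lemma wot_closed_adjoint_commute (x y c : H -> H) (A : set (H -> H)) :
  adjoint_pair dot x y -> (forall a, A a -> a \o x = x \o a) ->
  closure (matrix_coef dot @` A) (matrix_coef dot c) -> c \o x = x \o c.
Proof.
move=> xy Ax cA; apply/funext => u /=; apply: dot_inj => v.
pose F (g : {ptws H * H -> R[i]^o}) : R[i]^o := g (x u, v) - g (u, y v).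
have F0 : closed (F @^-1` [set 0]).
  apply: preimage_closed; last first.
    exact/accessible_closed_set1/hausdorff_accessible/norm_hausdorff.
  move=> g _; apply: (@continuousB _ R[i]^o); exact: proj_continuous.
have : (F @^-1` [set 0]) (matrix_coef dot c).
  move: cA; rewrite closureE; apply; split=> // _ [a Aa <-].
  rewrite /F /matrix_coef /=; apply/eqP; rewrite subr_eq0 -xy.
  by have /(congr1 (fun f => f u)) /= -> := Ax a Aa.
by rewrite /F /matrix_coef /= => /eqP; rewrite subr_eq0 -xy => /eqP.
Qed.

Lemma relative_commutant_vna (S : set (H -> H)) : S `<=` M ->
  (forall x, S x -> exists2 y, S y & adjoint_pair dot x y) ->
  von_neumann_algebra dot (relative_commutant S).
Proof.
move=> SM Sadj; split.
- by move=> c [Mc _]; exact: (vna_bounded hM).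
- by split; first exact: (vna_one hM).
- move=> k a c [Ma ha] [Mc hc]; split; first exact: (vna_lin hM).
  move=> x Sx; apply/funext => v /=.
  have [lx _] := vna_bounded hM (SM _ Sx).
  rewrite !fctE lx.
  have /(congr1 (fun f => f v)) /= <- := ha x Sx.
  by have /(congr1 (fun f => f v)) /= <- := hc x Sx.
- move=> a c [Ma ha] [Mc hc]; split; first exact: (vna_mul hM).
  by move=> x Sx; rewrite -compA hc // compA ha.
- move=> a [Ma ha]; have [c Mc ac] := vna_adj hM Ma.
  exists c => //; split=> // x Sx; have [y Sy xy] := Sadj x Sx.
  apply/funext => v /=; apply: dot_inj => u.
  rewrite xy (adjoint_pair_sym ac) (adjoint_pair_sym ac) xy.
  by have /(congr1 (fun f => f u)) /= -> := ha y Sy.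
- move=> c bc cS; split.
    apply: (vna_closed hM) => //; apply: closureS cS.
    by apply: image_subset => a [].
  move=> x Sx; have [y Sy xy] := Sadj x Sx.
  by apply: wot_closed_adjoint_commute xy _ cS => a [_]; exact.
Qed.

(** [S] lies in its relative commutant [C] and in the relative commutant of [C].
    Both are von Neumann algebras, so they contain the algebra generated by
    [S], and any element of the first commutes with any of the second. *)
Lemma generated_vna_abelian (S : set (H -> H)) : S `<=` M ->
  (forall x, S x -> self_adjoint dot x) ->
  (forall x y, S x -> S y -> x \o y = y \o x) ->
  abelian_ops (generated_vna dot M S).
Proof.
move=> SM Ssa Sc a c.
have V1 : von_neumann_algebra dot (relative_commutant S).
  by apply: relative_commutant_vna => // x Sx; exists x => //; exact: Ssa.
have V2 : von_neumann_algebra dot (relative_commutant (relative_commutant S)).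
  apply: relative_commutant_vna => [x []//|x Cx].
  by have [y Cy xy] := vna_adj V1 Cx; exists y.
move=> Na Nc.
have [_ ha] : relative_commutant (relative_commutant S) a.
  apply: Na; split; first by split=> // x [].
  by move=> x Sx; split; [exact: SM|move=> y [_ hy]; rewrite hy].
apply: ha; apply: Nc; split; first by split=> // x [].
by move=> x Sx; split; [exact: SM|move=> y Sy; exact: Sc].
Qed.

End Commutant.

Theorem theorem6p1 (R : realType) (H : completeNormedModType R[i])
    (dot : inner_product H) (M : set (H -> H)) (tau : (H -> H) -> R[i])
    (n : nat) (b : 'I_n -> H -> H)
    (hH : induces_norm dot)
    (hM : von_neumann_algebra dot M)
    (hfin : finite_vna dot M)
    (htau : faithful_normal_tracial_state dot M tau)
    (hn : (0 < n)%N)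
    (hb : forall i, M (b i) /\ self_adjoint dot (b i))
    (hB : countable (extreme_points (spectral_scale dot M tau b))) :
  abelian_ops (generated_vna dot M (range b `|` [set id])).
Proof.
have Mb i := (hb i).1; have sb i := (hb i).2.
pose b' i := Op hM (Mb i).
have sb' i : sa (b' i) by apply/self_adjoint_sa; exact: sb.
have cb i j : b i \o b j = b j \o b i.
  exact: (congr1 (@opfun _ _ _ _ _) (generators_commute hH htau sb' hB i j)).
apply: generated_vna_abelian => //.
- by move=> _ [[i _ <-]|->]; [exact: Mb|exact: (vna_one hM)].
- by move=> _ [[i _ <-]|->]; [exact: sb|].
- by move=> _ _ [[i _ <-]|->] [[j _ <-]|->].
Qed.
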